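(* Let $\rho_{A_1A_2\cdots A_n}$ be an $n$-qubit state, and let $k\geq 1$, $0<q\leq 1$, $0<s\leq 1$, $\beta\geq s$. Put $l=\frac{(1+k)^{\beta/s}-q^{\beta/s}}{k^{\beta/s}}$. Write $\mathcal N_{a,A_1A_i}=\mathcal N_a(\rho_{A_1A_i})$ and $\mathcal N_{a,A_1|A_{j+1}\cdots A_n}=\mathcal N_a(\rho_{A_1|A_{j+1}\cdots A_n})$ (so $\mathcal N_{a,A_1|A_n}=\mathcal N_{a,A_1A_n}$). (1) Let $n\geq 4$ and $2\leq m\leq n-2$. If $k\,\mathcal N^s_{a,A_1A_i}\leq \mathcal N^s_{a,A_1|A_{i+1}\cdots A_n}$ for $i=2,\dots,m$ and $\mathcal N^s_{a,A_1A_j}\geq k\,\mathcal N^s_{a,A_1|A_{j+1}\cdots A_n}$ for $j=m+1,\dots,n-1$, then $$\mathcal N^\beta_{a,A_1|A_2\cdots A_n}\leq q^{\beta/s}\big(\mathcal N^\beta_{a,A_1A_2}+l\mathcal N^\beta_{a,A_1A_3}+\cdots+l^{m-2}\mathcal N^\beta_{a,A_1A_m}\big)+l^m\big[\mathcal N^\beta_{a,A_1A_{m+1}}+q^{\beta/s}\mathcal N^\beta_{a,A_1A_{m+2}}+\cdots+q^{(n-m-2)\beta/s}\mathcal N^\beta_{a,A_1A_{n-1}}\big]+l^{m-1}q^{(n-m-1)\beta/s}\mathcal N^\beta_{a,A_1A_n}.$$ (2) Let $n\geq 3$. If $k\,\mathcal N^s_{a,A_1A_i}\leq \mathcal N^s_{a,A_1|A_{i+1}\cdots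 A_n}$ for $i=2,\dots,n-1$, then $$\mathcal N^\beta_{a,A_1|A_2\cdots A_n}\leq q^{\beta/s}\big(\mathcal N^\beta_{a,A_1A_2}+l\mathcal N^\beta_{a,A_1A_3}+\cdots+l^{n-3}\mathcal N^\beta_{a,A_1A_{n-1}}\big)+l^{n-2}\mathcal N^\beta_{a,A_1A_n}.$$ (3) Let $n\geq 3$. If $\mathcal N^s_{a,A_1A_j}\geq k\,\mathcal N^s_{a,A_1|A_{j+1}\cdots A_n}$ for $j=2,\dots,n-1$, then $$\mathcal N^\beta_{a,A_1|A_2\cdots A_n}\leq l\big[\mathcal N^\beta_{a,A_1A_2}+q^{\beta/s}\mathcal N^\beta_{a,A_1A_3}+\cdots+q^{(n-3)\beta/s}\mathcal N^\beta_{a,A_1A_{n-1}}\big]+q^{(n-2)\beta/s}\mathcal N^\beta_{a,A_1A_n}.$$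
   Context: For a bipartite pure state $|\varphi\rangle_{XY}$, its negativity is $\mathcal N(|\varphi\rangle)=\|(|\varphi\rangle\langle\varphi|)^{T_X}\|_{tr}-1=(\mathrm{tr}\sqrt{\rho_X})^2-1$, where $T_X$ is the partial transpose on $X$, $\|\cdot\|_{tr}$ the trace norm, $\rho_X=\mathrm{tr}_Y|\varphi\rangle\langle\varphi|$. The negativity of assistance of a bipartite state $\rho_{XY}$ is $\mathcal N_a(\rho_{XY})=\max\sum_ip_i\mathcal N(|\varphi_i\rangle)$ over all pure-state ensembles $\{p_i,|\varphi_i\rangle\}$ of $\rho_{XY}$. For the $n$-qubit state, $\rho_{A_1A_i}$ is the reduced state on $A_1A_i$ and $\rho_{A_1|A_{j+1}\cdots A_n}$ is the reduced state on $A_1A_{j+1}\cdots A_n$ regarded as bipartite for the cut $A_1$ versus $A_{j+1}\cdots A_n$. *)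

(* Defs.v *)
(* MathComp + MathComp-Analysis (reals, powR) + real-closed (complex R[i]). *)
From mathcomp Require Import all_boot all_order all_algebra.
From mathcomp Require Import complex.
From mathcomp Require Import boolp classical_sets reals exp.
Import Order.TTheory GRing.Theory Num.Theory.
Set Implicit Arguments. Unset Strict Implicit. Unset Printing Implicit Defensive.
Local Open Scope ring_scope.
Local Open Scope complex_scope.

Section Quantum.
Variable R : realType.
Local Notation C := R[i].

(* Linear operators on the Hilbert space C^T with orthonormal basis indexed by
   the finite type T, represented by their matrix entries. *)
Definition op (T : finType) := T -> T -> C.

Definition opmul (T : finType) (A B : op T) : op T :=
  fun x y => \sum_(z : T) A x z * B z y.

Definition optr (T : finType) (A : op T) : C := \sum_(x : T) A x x.

(* positive semidefinite: Hermitian with nonnegative quadratic form *)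
Definition psd (T : finType) (A : op T) : Prop :=
  (forall x y, A y x = (A x y)^*) /\
  (forall v : T -> C, 0 <= \sum_(x : T) \sum_(y : T) (v x)^* * A x y * v y).

(* density operator: positive semidefinite with unit trace *)
Definition density (T : finType) (A : op T) : Prop := psd A /\ optr A = 1.

(* tr sqrt(A): trace of the (unique) positive semidefinite square root of A
   (0 if A has no such square root, which never happens for psd A). *)
Definition trsqrt (T : finType) (A : op T) : C :=
  match pselect (exists B : op T, psd B /\ opmul B B = A) with
  | left h => optr (projT1 (cid h))
  | right _ => 0
  end.

(* reduced state rho_X = tr_Y |phi><phi| of a (bipartite) pure state vector *)
Definition redX (X Y : finType) (phi : (X * Y)%type -> C) : op X :=
  fun x x' => \sum_(y : Y) phi (x, y) * (phi (x', y))^*.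

(* negativity of a bipartite pure state: (tr sqrt rho_X)^2 - 1 *)
Definition negpure (X Y : finType) (phi : (X * Y)%type -> C) : R :=
  complex.Re ((trsqrt (redX phi)) ^+ 2) - 1.

Definition normalized (T : finType) (phi : T -> C) : Prop :=
  \sum_(t : T) phi t * (phi t)^* = 1.

(* v is the average negativity of some pure-state ensemble {p_i, |phi_i>} of rho *)
Definition ens_value (X Y : finType) (rho : op ((X * Y)%type)) (v : R) : Prop :=
  exists (m : nat) (p : 'I_m -> R) (phi : 'I_m -> (X * Y)%type -> C),
    [/\ forall i, 0 <= p i,
        \sum_(i < m) p i = 1,
        forall i, normalized (phi i),
        forall u w, rho u w = \sum_(i < m) (p i)%:C * phi i u * (phi i w)^*
      & v = \sum_(i < m) p i * negpure (phi i)].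

(* negativity of assistance: the maximum (supremum) over all pure-state ensembles *)
Definition negassist (X Y : finType) (rho : op ((X * Y)%type)) : R :=
  sup [set v | ens_value rho v].

(* ---- n-qubit systems: qubit A_(k+1) is index k : 'I_n, basis {0,1} = bool ---- *)
Definition qconf (n : nat) (S : {set 'I_n}) := {ffun {i : 'I_n | i \in S} -> bool}.

Definition getc (n : nat) (S : {set 'I_n}) (x : qconf S) (i : 'I_n) : bool :=
  match insub i with Some j => x j | None => false end.

(* joint configuration from configurations on SX, SY and the complement *)
Definition glue (n : nat) (SX SY : {set 'I_n}) (x : qconf SX) (y : qconf SY)
    (z : qconf (~: (SX :|: SY))) : {ffun 'I_n -> bool} :=
  [ffun i => if i \in SX then getc x i else if i \in SY then getc y i else getc z i].

(* reduced state on SX u SY (partial trace over the rest), regarded as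
   bipartite for the cut SX versus SY *)
Definition redbip (n : nat) (rho : op {ffun 'I_n -> bool}) (SX SY : {set 'I_n})
    : op ((qconf SX * qconf SY)%type) :=
  fun u w => \sum_(z : qconf (~: (SX :|: SY))) rho (glue u.1 u.2 z) (glue w.1 w.2 z).

Arguments redbip {n} rho SX SY _ _.
Arguments glue {n} SX SY x y z.

(* qubits whose 0-based index satisfies P *)
Definition qset (n : nat) (P : pred nat) : {set 'I_n} := [set i : 'I_n | P (val i)].

(* A_1 *)
Definition qA1 (n : nat) : {set 'I_n} := qset n (fun k => k == 0%N).

(* N_{a, A_1 A_i} *)
Definition NaPair (n : nat) (rho : op {ffun 'I_n -> bool}) (i : nat) : R :=
  negassist (redbip rho (qA1 n) (qset n (fun k => k == i.-1))).

(* N_{a, A_1 | A_{j+1} ... A_n} *)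
Definition NaTail (n : nat) (rho : op {ffun 'I_n -> bool}) (j : nat) : R :=
  negassist (redbip rho (qA1 n) (qset n (fun k => (j <= k)%N))).

End Quantum.

(* Main.v *)
Require Import Defs.
From mathcomp Require Import all_boot all_order all_algebra.
From mathcomp Require Import complex ring lra zify.
From mathcomp Require Import interval_inference convex hoelder.
From mathcomp Require Import boolp classical_sets reals exp.
Import Order.TTheory GRing.Theory Num.Theory.
Set Implicit Arguments. Unset Strict Implicit. Unset Printing Implicit Defensive.
Local Open Scope ring_scope.
(** For a pure state of a qubit [X] and a system [Y] the negativity is
    [2 sqrt (det rho_X) = sqrt (2 * sum |M(y,y')|^2)], where
    [M(y,y') = phi(0,y) phi(1,y') - phi(1,y) phi(0,y')].  If [Y] splits as [B D],
    then [sum |M|^2 = F_B + F_D], where [F_B] collects the part of [M] symmetric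
    in the [D]-indices, i.e. the values [b(psi_d, psi_d')] of a vector-valued
    symmetric bilinear form on the slices [psi_d] of [phi].

    Any ensemble with the same Gram operator as [(psi_d)] decomposes the reduced
    state on [X B], and [sum |b(psi_d, psi_d')|^2] depends on the Gram operator
    only.  If [sum |b(psi_d, psi_d)|] were bounded away from [sqrt F_B] on all these
    ensembles, some pair would satisfy
    [|b(psi_d, psi_d')|^2 > |b(psi_d, psi_d)| |b(psi_d', psi_d')|], and rotating
    this pair would increase the sum by a fixed amount, which cannot go on forever.
    So the negativity of assistance on [X B] is at least [sqrt (2 F_B)], and
    averaging over an ensemble gives [N_a(X|BD) <= N_a(XB) + N_a(XD)].

    Subadditivity of [x^s] and convexity of [x^(beta/s)] turn this into one step of
    the claimed inequalities, which are then iterated. *)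

(** * Power inequalities *)

(** Both [h + a] and [x] lie between [a] and [h + x], with complementary weights [c] and [1 - c];
    convexity is applied to each and the two bounds are added. *)
Lemma powR_majorization (R : realType) (t h a x : R) :
  1 <= t -> 0 <= h -> 0 <= a -> a <= x ->
  (h + a) `^ t + x `^ t <= (h + x) `^ t + a `^ t.
Proof.
move=> t1 h0 a0 ax.
have [e0|e0] := eqVneq (h + x - a) 0.
  by have -> : x = a; [lra|].
have e1 : 0 < h + x - a by rewrite lt_neqAle eq_sym e0 /=; lra.
pose c := (x - a) / (h + x - a).
have c0 : 0 <= c by rewrite divr_ge0 //; lra.
have c1 : c <= 1 by rewrite ler_pdivrMr //; lra.
have ce : c * (h + x - a) = x - a by rewrite divfK.
have cvx (d : R) (d0 : 0 <= d) (d1 : d <= 1) :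
    (d * a + (1 - d) * (h + x)) `^ t <= d * a `^ t + (1 - d) * (h + x) `^ t.
  by apply: (convex_powR t1 (Itv01 d0 d1)); rewrite inE /= in_itv /= andbT; lra.
have c0' : 0 <= 1 - c by lra.
have c1' : 1 - c <= 1 by lra.
have := cvx c c0 c1; have := cvx (1 - c) c0' c1'.
have -> : c * a + (1 - c) * (h + x) = h + a by lra.
have -> : (1 - c) * a + (1 - (1 - c)) * (h + x) = x by lra.
lra.
Qed.

(** Majorization with exponent 1/s and [a = 0], applied to x^s and y^s; the result is then raised to
    the power [s]. *)
Lemma powR_subadditive (R : realType) (s x y : R) :
  0 < s <= 1 -> 0 <= x -> 0 <= y -> (x + y) `^ s <= x `^ s + y `^ s.
Proof.
move=> /andP[s0 s1] x0 y0.
have t1 : 1 <= s^-1 by rewrite invf_ge1.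
have := @powR_majorization _ s^-1 (x `^ s) 0 (y `^ s) t1
  (powR_ge0 _ _) (lexx _) (powR_ge0 _ _).
rewrite addr0 powR0 ?invr_eq0 ?gt_eqF// addr0 -!powRrM divff ?gt_eqF//.
rewrite !powRr1// => h.
rewrite -[leRHS](@powRr1 _ (x `^ s + y `^ s)) ?addr_ge0 ?powR_ge0//.
rewrite -[X in _ <= _ `^ X](@mulVf _ s) ?gt_eqF// powRrM.
by apply: ge0_ler_powR => //; rewrite ?nnegrE ?powR_ge0 ?addr_ge0// ltW.
Qed.

Lemma powR_add_le_weighted (R : realType) (t k q x y : R) :
  1 <= t -> 0 < k -> 0 < q <= 1 -> 0 <= y -> k * y <= x ->
  (x + y) `^ t <= q `^ t * y `^ t + ((1 + k) `^ t - q `^ t) / k `^ t * x `^ t.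
Proof.
move=> t1 k0 /andP[q0 q1] y0 yx.
have ky0 : 0 <= k * y by rewrite mulr_ge0 // ltW.
have x0 : 0 <= x by apply: le_trans yx.
have kx0 : 0 <= k * x by rewrite mulr_ge0 // ltW.
(* This is the case q = 1 of the claim, multiplied by k^t. *)
have := powR_majorization t1 kx0 ky0 yx.
have qt : q `^ t <= 1.
  by rewrite -[leRHS](powRr0 q); apply: ger_powR; rewrite ?q0 //; lra.
have mono : (k * y) `^ t <= x `^ t.
  by apply: ge0_ler_powR => //; rewrite ?nnegrE //; lra.
rewrite -mulrDr -[X in (k * x + X)](mul1r x) -mulrDl [k + 1]addrC.
rewrite !powRM ?addr_ge0 //; try lra.
rewrite powRM // in mono; last exact: ltW.
have kt : 0 < k `^ t by rewrite powR_gt0.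
move=> maj.
rewrite -(ler_pM2l kt) mulrDr.
have -> : k `^ t * (((1 + k) `^ t - q `^ t) / k `^ t * x `^ t) =
          ((1 + k) `^ t - q `^ t) * x `^ t.
  by field; rewrite gt_eqF.
(* Passing from 1 to [q] moves the weight 1 - q^t from (k y)^t to the larger x^t. *)
have : 0 <= (1 - q `^ t) * (x `^ t - k `^ t * y `^ t) by apply: mulr_ge0; lra.
lra.
Qed.

(** * Vector-valued symmetric bilinear forms on ensembles *)

Section Forms.
Local Open Scope complex_scope.
Variable R : realType.
Local Notation C := R[i].

Definition sqn (z : C) : R := complex.Re z ^+ 2 + complex.Im z ^+ 2.

Lemma sqn_ge0 z : 0 <= sqn z.
Proof. by rewrite addr_ge0 ?sqr_ge0. Qed.

Lemma sqnM z w : sqn (z * w) = sqn z * sqn w.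
Proof. case: z w => [a b] [c d]; rewrite /sqn /=; ring. Qed.

Lemma sqnC (a : R) : sqn a%:C = a ^+ 2.
Proof. by rewrite /sqn /= expr0n addr0. Qed.

Lemma Re_sum (I : finType) (F : I -> C) :
  complex.Re (\sum_i F i) = \sum_i complex.Re (F i).
Proof. by apply: (big_morph (@complex.Re R)) => // -[a b] [c d]. Qed.

Lemma mulJc z : z * conjc z = (sqn z)%:C.
Proof.
case: z => a b; apply/eqP; rewrite eq_complex /sqn /=.
by apply/andP; split; apply/eqP; ring.
Qed.

(** For z != 0 the witness is i conj(z) / |z|, which makes the product purely imaginary. *)
Lemma unit_orthogonal (z : C) :
  exists2 e : C, sqn e = 1 & complex.Re (e * z) = 0.
Proof.
case: z => a b; have [ab0|ab0] := eqVneq (a ^+ 2 + b ^+ 2) 0.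
  exists 1; first by rewrite /sqn /=; ring.
  rewrite mul1r /=; apply/eqP; rewrite -sqrf_eq0 eq_le sqr_ge0 andbT.
  by rewrite -ab0 lerDl sqr_ge0.
have ab1 : 0 <= a ^+ 2 + b ^+ 2 by rewrite addr_ge0 ?sqr_ge0.
pose r := Num.sqrt (a ^+ 2 + b ^+ 2).
have r2 : r ^+ 2 = a ^+ 2 + b ^+ 2 by rewrite sqr_sqrtr.
have r0 : r != 0 by apply: contra ab0 => /eqP r0; rewrite -r2 r0 expr0n.
exists ((b / r) +i* (a / r)); rewrite ?/sqn /=; last by field.
by rewrite !expr_div_n -mulrDl addrC r2 divff // expf_neq0.
Qed.

Section Bilinear.
Variables (V P : finType).

Definition nsq (f : P -> C) : R := \sum_p sqn (f p).

Lemma nsq_ge0 f : 0 <= nsq f.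
Proof. by apply: sumr_ge0 => p _; apply: sqn_ge0. Qed.

(** The operator sum_j |psi_j><psi_j|; the vectors need not be normalized, so ensemble weights can
    sit in their squared norms. *)
Definition gram (J : finType) (psi : J -> V -> C) : op R V :=
  fun u w => \sum_j psi j u * conjc (psi j w).

(** Each side is a quadratic form in [c] whose coefficients are the entries of the Gram operator. *)
Lemma sum_sqn_gram (J J' : finType) (psi : J -> V -> C) (chi : J' -> V -> C)
    (c : V -> C) :
  (forall u w, gram psi u w = gram chi u w) ->
  \sum_j sqn (\sum_v c v * psi j v) = \sum_j sqn (\sum_v c v * chi j v).
Proof.
move=> eqG; apply: (@complexI R).
suff E (I : finType) (f : I -> V -> C) : (\sum_j sqn (\sum_v c v * f j v))%:C =
    \sum_u \sum_w c u * conjc (c w) * gram f u w.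
  rewrite !E; apply: eq_bigr => u _; apply: eq_bigr => w _.
  by rewrite eqG.
rewrite rmorph_sum /=.
under eq_bigr => j _ do rewrite -mulJc rmorph_sum /= mulr_suml.
rewrite exchange_big /=; apply: eq_bigr => u _.
under eq_bigr => j _ do rewrite mulr_sumr.
rewrite exchange_big /=; apply: eq_bigr => w _.
rewrite /gram mulr_sumr; apply: eq_bigr => j _.
by rewrite rmorphM /=; ring.
Qed.

Variable K : P -> V -> V -> C.
Hypothesis Ksym : forall p u v, K p u v = K p v u.

Definition bform (f g : V -> C) (p : P) : C :=
  \sum_u \sum_v K p u v * f u * g v.

Lemma bformC f g p : bform f g p = bform g f p.
Proof.
rewrite /bform exchange_big /=; apply: eq_bigr => u _; apply: eq_bigr => v _.
by rewrite Ksym; ring.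
Qed.

Lemma bformDZ f g h a b p :
  bform (fun u => a * (f u + b * g u)) h p = a * (bform f h p + b * bform g h p).
Proof.
rewrite /bform mulr_sumr -big_split /= mulr_sumr; apply: eq_bigr => u _.
rewrite !mulr_sumr -big_split /= mulr_sumr; apply: eq_bigr => v _.
by ring.
Qed.

Definition frob (J : finType) (psi : J -> V -> C) : R :=
  \sum_j \sum_j' nsq (bform (psi j) (psi j')).

(** With one argument fixed, each component of the form is a linear functional of the other, so
    [sum_sqn_gram] exchanges the families one slot at a time; symmetry of [K] brings the second slot
    into position. *)
Lemma frob_gram (J : finType) (psi chi : J -> V -> C) :
  (forall u w, gram psi u w = gram chi u w) -> frob psi = frob chi.
Proof.
move=> eqG.
have one_slot (f : V -> C) :
    \sum_j nsq (bform f (psi j)) = \sum_j nsq (bform f (chi j)).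
  rewrite /nsq exchange_big [RHS]exchange_big /=; apply: eq_bigr => p _.
  have E (h : J -> V -> C) : \sum_j sqn (bform f (h j) p) =
      \sum_j sqn (\sum_v (\sum_u K p u v * f u) * h j v).
    apply: eq_bigr => j _; congr sqn; rewrite /bform exchange_big /=.
    by apply: eq_bigr => v _; rewrite mulr_suml.
  by rewrite !E; apply: sum_sqn_gram.
have flip (f g : V -> C) : nsq (bform f g) = nsq (bform g f).
  by apply: eq_bigr => p _; rewrite bformC.
rewrite /frob; under eq_bigr => j _ do rewrite one_slot.
rewrite exchange_big /=; apply: eq_bigr => j' _.
under eq_bigr => j _ do rewrite flip.
exact: one_slot.
Qed.

(** In the expanded squares, |e| = 1 gives conj(e^2 d1) e o the same real part as e d1 conj(o); the
    whole cross term becomes linear in [e], so one phase can control it. *)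
Lemma sqn_balanced (e d0 d1 o : C) : sqn e = 1 ->
  (sqn (2^-1 * (d0 + 2 * (e * o) + e ^+ 2 * d1)) =
    sqn (d0 + e ^+ 2 * d1) / 4 + sqn o +
    complex.Re (e * (conjc d0 * o + d1 * conjc o))) *
  (sqn (2^-1 * (d0 - 2 * (e * o) + e ^+ 2 * d1)) =
    sqn (d0 + e ^+ 2 * d1) / 4 + sqn o -
    complex.Re (e * (conjc d0 * o + d1 * conjc o))).
Proof.
move=> e1.
have half (z : C) : sqn (2^-1 * z) = sqn z / 4.
  rewrite sqnM mulrC; congr (_ * _).
  have -> : (2^-1 : C) = (2^-1 : R)%:C by rewrite fmorphV rmorph_nat.
  by rewrite sqnC; field.
(* [w] and [w'] are the coefficients of |e|^2 - 1 that make the identities hold for every [e], so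
   that they can be checked in real coordinates. *)
pose w := sqn o + complex.Re (conjc e * (conjc d1 * o)).
pose w' := sqn o - complex.Re (conjc e * (conjc d1 * o)).
have [E E'] : (sqn (d0 + 2 * (e * o) + e ^+ 2 * d1) / 4 =
      sqn (d0 + e ^+ 2 * d1) / 4 + sqn o +
      complex.Re (e * (conjc d0 * o + d1 * conjc o)) + (sqn e - 1) * w) /\
    (sqn (d0 - 2 * (e * o) + e ^+ 2 * d1) / 4 =
      sqn (d0 + e ^+ 2 * d1) / 4 + sqn o -
      complex.Re (e * (conjc d0 * o + d1 * conjc o)) + (sqn e - 1) * w').
  rewrite /w /w'; case: e d0 d1 o {e1 w w'} => [ea eb] [a0 b0] [a1 b1] [a b].
  by rewrite /sqn /=; split; field.
by split; rewrite half ?E ?E' e1 subrr mul0r addr0.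
Qed.

Definition norm2 (f : P -> C) : R := Num.sqrt (nsq f).

Lemma norm2_ge0 f : 0 <= norm2 f. Proof. exact: sqrtr_ge0. Qed.

Lemma sqr_norm2 f : norm2 f ^+ 2 = nsq f.
Proof. by rewrite sqr_sqrtr // nsq_ge0. Qed.

Definition same_pair_gram (f g f' g' : V -> C) :=
  forall u w, f' u * conjc (f' w) + g' u * conjc (g' w) =
              f u * conjc (f w) + g u * conjc (g w).

(* The new pair is (f +- e g) / sqrt 2, with the phase e chosen to kill the cross
   term that distinguishes the two norms. *)
Lemma half_turn f g : exists f' g',
  [/\ same_pair_gram f g f' g', nsq (bform f' f') = nsq (bform g' g')
    & nsq (bform f g) <= nsq (bform f' f')].
Proof.
pose al := \sum_p (conjc (bform f f p) * bform f g p +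
                   bform g g p * conjc (bform f g p)).
have [e e1 eal] := unit_orthogonal al.
have [r r2 rJ] : exists2 r : C, r * r = 2^-1 & conjc r = r.
  exists ((Num.sqrt 2)^-1 : R)%:C; last exact: conjc_real.
  rewrite -rmorphM /= -invfM -expr2 sqr_sqrtr ?ler0n //.
  by rewrite fmorphV rmorph_nat.
have eJ : e * conjc e = 1 by rewrite mulJc e1.
have B2 (c : C) p : bform (fun u => r * (f u + c * g u))
      (fun u => r * (f u + c * g u)) p =
    2^-1 * (bform f f p + 2 * (c * bform f g p) + c ^+ 2 * bform g g p).
  rewrite bformDZ (bformC f) (bformC g) !bformDZ -r2 (bformC g f); ring.
(* Componentwise the two squared norms are Y p + X p and Y p - X p; the choice of [e] makes the
   [X p] sum to zero. *)
pose X p := complex.Re (e * (conjc (bform f f p) * bform f g p +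
    bform g g p * conjc (bform f g p))).
pose Y p := sqn (bform f f p + e ^+ 2 * bform g g p) / 4 + sqn (bform f g p).
have X0 : \sum_p X p = 0.
  by rewrite -[RHS]eal /al mulr_sumr Re_sum.
have nf : nsq (bform (fun u => r * (f u + e * g u)) (fun u => r * (f u + e * g u)))
    = \sum_p Y p.
  transitivity (\sum_p Y p + \sum_p X p); last by rewrite X0 addr0.
  rewrite -big_split /=; apply: eq_bigr => p _.
  by rewrite B2 sqn_balanced.
exists (fun u => r * (f u + e * g u)), (fun u => r * (f u + (- e) * g u)); split.
- move=> u w; rewrite !rmorphM /= !rmorphD /= !rmorphM /= rmorphN /= rJ.
  transitivity (r * r * 2 * (f u * conjc (f w) + e * conjc e * (g u * conjc (g w)))).
    ring.
  by rewrite r2 eJ mul1r mulVf ?mul1r // pnatr_eq0.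
- rewrite nf; transitivity (\sum_p Y p - \sum_p X p); first by rewrite X0 subr0.
  rewrite -sumrB; apply: eq_bigr => p _.
  by rewrite B2 sqrrN mulNr mulrN sqn_balanced.
- rewrite nf; apply: ler_sum => p _; rewrite /Y lerDr divr_ge0 ?sqn_ge0 //.
Qed.

Lemma pair_frobE f g : frob (fun b : bool => if b then f else g) =
  nsq (bform f f) + nsq (bform g g) + 2 * nsq (bform f g).
Proof.
rewrite /frob !big_bool /= (_ : nsq (bform g f) = nsq (bform f g)); first ring.
by apply: eq_bigr => p _; rewrite bformC.
Qed.

(** The left side T depends only on the Gram operator of the pair. After a half turn both squared
    diagonal norms equal some D. If 4 D < T, the squared off-diagonal norm T/2 - D exceeds T/4, and
    a second half turn makes it a lower bound for the diagonal ones. *)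
Lemma pair_improvement f g : exists f' g', same_pair_gram f g f' g' /\
  nsq (bform f f) + nsq (bform g g) + 2 * nsq (bform f g) <=
    (norm2 (bform f' f') + norm2 (bform g' g')) ^+ 2.
Proof.
have inv f1 g1 f2 g2 : same_pair_gram f1 g1 f2 g2 ->
    nsq (bform f2 f2) + nsq (bform g2 g2) + 2 * nsq (bform f2 g2) =
    nsq (bform f1 f1) + nsq (bform g1 g1) + 2 * nsq (bform f1 g1).
  move=> h; rewrite -!pair_frobE; apply: frob_gram => u w.
  by rewrite /gram !big_bool /= h.
have eqn f1 g1 : nsq (bform f1 f1) = nsq (bform g1 g1) ->
    (norm2 (bform f1 f1) + norm2 (bform g1 g1)) ^+ 2 = 4 * nsq (bform f1 f1).
  by rewrite /norm2 => <-; rewrite -[in RHS]sqr_norm2 /norm2; ring.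
have [f1 [g1 [G1 E1 L1]]] := half_turn f g.
have [h|h] := leP (nsq (bform f f) + nsq (bform g g) + 2 * nsq (bform f g))
  (4 * nsq (bform f1 f1)); first by exists f1, g1; split; rewrite // eqn.
have [f2 [g2 [G2 E2 L2]]] := half_turn f1 g1.
exists f2, g2; split; first by move=> u w; rewrite G2 G1.
by rewrite eqn //; move: h; rewrite -(inv _ _ _ _ G1) -E1; lra.
Qed.

Lemma gram_replace_pair (J : finType) (psi : J -> V -> C) a b f' g' :
  a != b -> same_pair_gram (psi a) (psi b) f' g' ->
  forall u w, gram (fun j => if j == a then f' else if j == b then g' else psi j) u w
            = gram psi u w.
Proof.
move=> ab h u w; have ba : b != a by rewrite eq_sym.
rewrite /gram (bigD1 a) //= (bigD1 b) //=.
rewrite [RHS](bigD1 a) //= [X in _ = _ + X](bigD1 b) //=.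
rewrite !eqxx (negPf ba) !addrA h; congr (_ + _).
by apply: eq_bigr => j /andP[/negPf -> /negPf ->].
Qed.

(** For the kernel of the minors, sqrt 2 times this sum is the average negativity of the ensemble
    given by [psi]. *)
Definition diagsum (J : finType) (psi : J -> V -> C) : R :=
  \sum_j norm2 (bform (psi j) (psi j)).

Lemma diagsum_ge0 (J : finType) (psi : J -> V -> C) : 0 <= diagsum psi.
Proof. by apply: sumr_ge0 => j _; apply: norm2_ge0. Qed.

(* If the diagonal sum falls short, some off-diagonal entry exceeds the geometric
   mean of its two diagonal entries, and turning that pair increases the sum. *)
Lemma diagsum_improvement (J : finType) (psi : J -> V -> C) (d eta : R) :
  0 < d -> diagsum psi ^+ 2 + #|J|%:R ^+ 2 * d < frob psi ->
  0 <= eta -> 2 * diagsum psi * eta + eta ^+ 2 <= 2 * d ->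
  exists2 psi' : J -> V -> C, (forall u w, gram psi' u w = gram psi u w)
    & diagsum psi + eta <= diagsum psi'.
Proof.
move=> d0 short eta0 etad.
pose t j := norm2 (bform (psi j) (psi j)).
have t0 j : 0 <= t j by apply: norm2_ge0.
(* Otherwise summing over all pairs would bound [frob psi] by the left side of [short]. *)
have [a [b gap]] : exists a b, t a * t b + d <= nsq (bform (psi a) (psi b)).
  apply: contrapT => nogap.
  have : frob psi <= \sum_j \sum_j' (t j * t j' + d).
    apply: ler_sum => j _; apply: ler_sum => j' _; rewrite leNgt; apply/negP => h.
    by apply: nogap; exists j, j'; apply: ltW.
  apply/negP; rewrite -ltNge; apply: le_lt_trans short.
  under eq_bigr => j _ do rewrite big_split /= -mulr_sumr sumr_const.
  rewrite big_split /= -mulr_suml sumr_const expr2 lerD2l.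
  by rewrite -mulrnA -[leLHS]mulr_natl natrM.
have ab : a != b.
  apply/eqP => ab; move: gap; rewrite ab -expr2 sqr_norm2; lra.
have ba : b != a by rewrite eq_sym.
have [f' [g' [G imp]]] := pair_improvement (psi a) (psi b).
exists (fun j => if j == a then f' else if j == b then g' else psi j).
  exact: gram_replace_pair.
have split2 (F : J -> R) : \sum_j F j = F a + F b + \sum_(j | (j != a) && (j != b)) F j.
  by rewrite (bigD1 a) //= (bigD1 b) //= addrA.
rewrite /diagsum !split2 -/(t a) -/(t b) !eqxx (negPf ba).
set S := \sum_(j | _) _; set S' := \sum_(j | _) _.
have -> : S' = S by apply: eq_bigr => j /andP[/negPf -> /negPf ->].
have S0 : 0 <= S by apply: sumr_ge0 => j _; apply: norm2_ge0.
move: etad; rewrite /diagsum split2 -/S -/(t a) -/(t b) => etad.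
suff : t a + t b + eta <= norm2 (bform f' f') + norm2 (bform g' g') by lra.
(* By [imp] and [gap] the square of the right side is at least (t a + t b)^2 + 2 d, and [etad] with
   S >= 0 leaves room for [eta]. *)
rewrite -(@ler_pXn2r _ 2) ?nnegrE ?addr_ge0 ?norm2_ge0 //.
apply: le_trans imp; rewrite -!sqr_norm2 -/(t a) -/(t b) sqr_norm2.
have : 0 <= S * eta by rewrite mulr_ge0.
lra.
Qed.

Lemma diagsum_approx (J : finType) (psi : J -> V -> C) (eps : R) : 0 < eps ->
  exists2 psi' : J -> V -> C, (forall u w, gram psi' u w = gram psi u w)
    & Num.sqrt (frob psi) - eps <= diagsum psi'.
Proof.
move=> eps0; apply: contrapT => noapprox.
set f := Num.sqrt (frob psi) in noapprox.
have small (chi : J -> V -> C) :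
    (forall u w, gram chi u w = gram psi u w) -> diagsum chi < f - eps.
  by move=> G; rewrite ltNge; apply/negP => h; apply: noapprox; exists chi.
have f2 : f ^+ 2 = frob psi.
  by rewrite sqr_sqrtr //; do 2 apply: sumr_ge0 => ? _; apply: nsq_ge0.
have feps : eps < f.
  by have := diagsum_ge0 psi; have := small psi (fun _ _ => erefl); lra.
pose c := f ^+ 2 - (f - eps) ^+ 2.
have c0 : 0 < c.
  have -> : c = eps * (f + (f - eps)) by rewrite /c; ring.
  by rewrite mulr_gt0 //; lra.
pose N : R := #|J|%:R ^+ 2.
have N0 : 0 <= N by apply: sqr_ge0.
(* Every family short by [eps] has a deficit of at least [c] in the squares; [d] keeps N d below it,
   and N + 1 keeps the denominator positive. *)
pose d := c / (N + 1) / 2.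
have d0 : 0 < d by rewrite !divr_gt0 //; lra.
have Nd : N * d < c.
  have -> : N * d = c / 2 - d by rewrite /d; field; lra.
  lra.
(* Diagonal sums stay below [f], so one gain serves every family: 2 f eta + eta^2 <= eta (2 f + 1)
   <= 2 d. *)
pose eta := Num.min 1 (2 * d / (2 * f + 1)).
have eta0 : 0 < eta by rewrite lt_min ltr01 divr_gt0 //; lra.
have eta1 : eta <= 1 by rewrite ge_min lexx.
have etad : eta * (2 * f + 1) <= 2 * d.
  by rewrite -ler_pdivlMr; [rewrite ge_min lexx orbT|lra].
have climb m : exists2 chi : J -> V -> C,
    (forall u w, gram chi u w = gram psi u w) & m%:R * eta <= diagsum chi.
  elim: m => [|m [chi G le]]; first by exists psi; rewrite // mul0r diagsum_ge0.
  have T0 := diagsum_ge0 chi; have T1 := small chi G.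
  have [] := @diagsum_improvement J chi d eta d0; rewrite ?(ltW eta0) //.
  - rewrite (frob_gram G) -f2 -/N.
    have : diagsum chi ^+ 2 <= (f - eps) ^+ 2.
      by rewrite ler_pXn2r ?nnegrE //; lra.
    move: Nd; rewrite /c; lra.
  - have : 0 <= (f - diagsum chi) * eta by rewrite mulr_ge0 //; lra.
    have : 0 <= eta * (1 - eta) by rewrite mulr_ge0 //; lra.
    lra.
  move=> chi' G' le'; exists chi' => [u w|]; first by rewrite G' G.
  by rewrite -natr1 mulrDl mul1r; lra.
have [chi G le] := climb (Num.truncn (f / eta)).+1.
have := small chi G.
have : f / eta < (Num.truncn (f / eta)).+1%:R.
  by rewrite truncnS_gt.
rewrite ltr_pdivrMr //; lra.
Qed.

End Bilinear.
End Forms.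

(** * Negativity of a qubit and of its assistance *)

Section Qubit.
Local Open Scope complex_scope.
Variables (R : realType) (X : finType) (x0 x1 : X).
Local Notation C := R[i].
Hypothesis x01 : x0 != x1.
Hypothesis qubitX : forall x, (x == x0) || (x == x1).

Lemma sum_qubit (W : zmodType) (F : X -> W) : \sum_x F x = F x0 + F x1.
Proof.
rewrite (bigD1 x0) //= (bigD1 x1) 1?eq_sym //= big1 ?addr0 // => x.
by case/andP=> /negPf h0 /negPf h1; have := qubitX x; rewrite h0 h1.
Qed.

Definition minors (Y : finType) (f : X * Y -> C) (p : Y * Y) : C :=
  f (x0, p.1) * f (x1, p.2) - f (x1, p.1) * f (x0, p.2).

(** Cauchy-Binet for rho_X as the product of the two-row coefficient matrix and its adjoint; the
    factor 2 arises because ordered pairs count each minor twice. *)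
Lemma nsq_minors (Y : finType) (f : X * Y -> C) :
  (nsq (minors f))%:C =
  2 * (redX f x0 x0 * redX f x1 x1 - redX f x0 x1 * redX f x1 x0).
Proof.
pose G (x x' : X) (y : Y) := f (x, y) * conjc (f (x', y)).
transitivity (\sum_y \sum_y' (G x0 x0 y * G x1 x1 y' + G x1 x1 y * G x0 x0 y'
    - (G x0 x1 y * G x1 x0 y' + G x1 x0 y * G x0 x1 y'))).
  rewrite rmorph_sum /= -(pair_bigA _ (fun y y' => (sqn (minors f (y, y')))%:C)) /=.
  apply: eq_bigr => y _; apply: eq_bigr => y' _.
  by rewrite -mulJc /minors /G /= rmorphB /= !rmorphM /=; ring.
have prod (a b c d : X) :
    redX f a b * redX f c d = \sum_y \sum_y' G a b y * G c d y'.
  exact: big_distrlr.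
transitivity (redX f x0 x0 * redX f x1 x1 + redX f x1 x1 * redX f x0 x0 -
  (redX f x0 x1 * redX f x1 x0 + redX f x1 x0 * redX f x0 x1)); last ring.
rewrite !prod -!big_split -sumrB /=; apply: eq_bigr => y _.
by rewrite -!big_split -sumrB.
Qed.

Lemma redX_herm (Y : finType) (f : X * Y -> C) x x' :
  redX f x' x = conjc (redX f x x').
Proof.
rewrite /redX rmorph_sum /=; apply: eq_bigr => y _.
by rewrite rmorphM /= conjcK mulrC.
Qed.

Lemma redX_diag (Y : finType) (f : X * Y -> C) x :
  redX f x x = (nsq (fun y => f (x, y)))%:C.
Proof. by rewrite /nsq rmorph_sum /=; apply: eq_bigr => y _; rewrite -mulJc. Qed.

Lemma redX_form_ge0 (Y : finType) (f : X * Y -> C) (v : X -> C) :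
  0 <= \sum_x \sum_x' conjc (v x) * redX f x x' * v x'.
Proof.
pose h y := \sum_x conjc (v x) * f (x, y).
suff -> : \sum_x \sum_x' conjc (v x) * redX f x x' * v x' = (nsq h)%:C.
  by rewrite ler0c nsq_ge0.
rewrite /nsq rmorph_sum /=.
transitivity (\sum_y \sum_x \sum_x'
    conjc (v x) * f (x, y) * (conjc (f (x', y)) * v x')).
  rewrite [RHS]exchange_big /=; apply: eq_bigr => x _.
  rewrite [RHS]exchange_big /=; apply: eq_bigr => x' _.
  rewrite /redX mulr_sumr mulr_suml; apply: eq_bigr => y _; ring.
apply: eq_bigr => y _; rewrite -mulJc /h rmorph_sum /= big_distrlr /=.
apply: eq_bigr => x _; apply: eq_bigr => x' _.
by rewrite rmorphM /= conjcK [conjc _ * v x']mulrC.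
Qed.

Lemma psd_qubit_det (B : op R X) : psd B ->
  [/\ B x1 x0 = conjc (B x0 x1),
      exists2 p, 0 <= p & B x0 x0 = p%:C,
      exists2 r, 0 <= r & B x1 x1 = r%:C
    & sqn (B x0 x1) <= complex.Re (B x0 x0) * complex.Re (B x1 x1)].
Proof.
case=> herm form.
have form2 (al be : C) : 0 <= conjc al * B x0 x0 * al + conjc al * B x0 x1 * be
    + (conjc be * B x1 x0 * al + conjc be * B x1 x1 * be).
  have := form (fun x => if x == x0 then al else be).
  by rewrite !sum_qubit !eqxx [x1 == x0]eq_sym (negPf x01).
have [p p0 E0] : exists2 p, 0 <= p & B x0 x0 = p%:C.
  have := form2 1 0; rewrite conjc0 conjc1 !(mulr0, mul0r, addr0, mul1r, mulr1).
  case: (B x0 x0) => a b; rewrite lecE /= => /andP[/eqP -> a0].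
  by exists a.
have [r r0 E1] : exists2 p, 0 <= p & B x1 x1 = p%:C.
  have := form2 0 1; rewrite conjc0 conjc1 !(mulr0, mul0r, add0r, mul1r, mulr1).
  case: (B x1 x1) => a b; rewrite lecE /= => /andP[/eqP -> a0].
  by exists a.
have EJ : B x1 x0 = conjc (B x0 x1) by rewrite (herm x0 x1).
split=> //; [by exists p | by exists r |].
rewrite E0 E1 /=; move: form2; rewrite E0 E1 EJ.
case: (B x0 x1) => a b /= form2.
rewrite /sqn /=.
(* With w = B x0 x1 and D = p r - |w|^2, the test vectors (w, -p) and (-r, conj w) give p D >= 0 and
   r D >= 0; (-w, 1) settles p = r = 0 by forcing w = 0. *)
have := form2 (a +i* b) (- p%:C); have := form2 (- r%:C) (a -i* b).
have := form2 (- (a +i* b)) 1.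
rewrite !lecE /= => /andP[_ h1] /andP[_ h2] /andP[_ h3].
have {h2} h2 : 0 <= r * (p * r - (a ^+ 2 + b ^+ 2)) by move: h2; lra.
have {h3} h3 : 0 <= p * (p * r - (a ^+ 2 + b ^+ 2)) by move: h3; lra.
have [pr|pr] := leP (p + r) 0.
  have [p00 r00] : p = 0 /\ r = 0 by split; lra.
  by move: h1; rewrite p00 r00; have := sqr_ge0 a; have := sqr_ge0 b; lra.
rewrite -subr_ge0 -(pmulr_rge0 _ pr) mulrDl addr_ge0 //.
Qed.

(** [trsqrt] picks some root, so an arbitrary psd root B is treated: (tr B)^2 = tr(B^2) + 2 det B,
    and det B, being nonnegative, is the square root of det rho_X. *)
Lemma trsqrt_qubit (Y : finType) (f : X * Y -> C) : normalized f ->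
  trsqrt (redX f) ^+ 2 = (1 + Num.sqrt (2 * nsq (minors f)))%:C.
Proof.
move=> f1.
set a := nsq (fun y => f (x0, y)); set b := nsq (fun y => f (x1, y)).
have ra : redX f x0 x0 = a%:C := redX_diag f x0.
have rb : redX f x1 x1 = b%:C := redX_diag f x1.
have rz := redX_herm f x0 x1.
set z := redX f x0 x1 in rz.
have ab1 : a + b = 1.
  apply: (@complexI R); rewrite rmorphD /= -ra -rb -[RHS]f1.
  rewrite -(sum_qubit (fun x => redX f x x)) /redX.
  by rewrite pair_bigA; apply: eq_bigr => -[x y].
have mE : nsq (minors f) = 2 * (a * b - sqn z).
  apply: (@complexI R); rewrite nsq_minors ra rb rz mulJc.
  by rewrite rmorphM rmorph_nat rmorphB rmorphM.
have d0 : 0 <= a * b - sqn z by have := nsq_ge0 (minors f); rewrite mE; lra.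
pose s := Num.sqrt (a * b - sqn z).
have s0 : 0 <= s := sqrtr_ge0 _.
have s2 : s ^+ 2 = a * b - sqn z by rewrite sqr_sqrtr.
have -> : Num.sqrt (2 * nsq (minors f)) = 2 * s.
  rewrite mE mulrA -natrM sqrtrM ?ler0n // (_ : (2 * 2)%N%:R = 2 ^+ 2 :> R).
    by rewrite sqrtr_sqr ger0_norm ?ler0n.
  by rewrite -natrX.
(* The default value 0 is ruled out by exhibiting a root: by Cayley-Hamilton, (rho_X + s) / t
   squares to rho_X when s^2 = det rho_X and t^2 = 1 + 2 s. *)
rewrite /trsqrt; case: pselect => [h|]; last first.
  case.
  pose t := Num.sqrt (1 + 2 * s).
  have t2 : t ^+ 2 = 1 + 2 * s by rewrite sqr_sqrtr //; lra.
  have tp : 0 < t by rewrite sqrtr_gt0; lra.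
  have tn : t%:C != 0 by rewrite (inj_eq (@complexI R)) gt_eqF.
  have ti0 : 0 <= (t^-1)%:C by rewrite ler0c invr_ge0 ltW.
  exists (fun x x' => (t^-1)%:C * (redX f x x' + (x == x')%:R * s%:C)); split.
    split.
      have conjM (u v : C) : conjc (u * v) = conjc u * conjc v by rewrite rmorphM.
      have conjD (u v : C) : conjc (u + v) = conjc u + conjc v by rewrite rmorphD.
      move=> x x'; rewrite redX_herm eq_sym conjM conjD conjM.
      by rewrite !conjc_real conjc_nat.
    move=> v.
    have -> : \sum_x \sum_x' conjc (v x) *
        ((t^-1)%:C * (redX f x x' + (x == x')%:R * s%:C)) * v x' =
      (t^-1)%:C * (\sum_x \sum_x' conjc (v x) * redX f x x' * v x' +
         s%:C * \sum_x conjc (v x) * v x).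
      rewrite !sum_qubit !eqxx [x1 == x0]eq_sym (negPf x01) /= ?mul0r ?mul1r; ring.
    apply: mulr_ge0 => //; apply: addr_ge0; first exact: redX_form_ge0.
    apply: mulr_ge0; first by rewrite ler0c.
    by apply: sumr_ge0 => x _; rewrite mulrC mulcJ_ge0.
  have S2 : s%:C * s%:C = a%:C * b%:C - z * conjc z.
    by rewrite mulJc -!rmorphM -expr2 s2 rmorphB.
  have T2 : t%:C * t%:C = a%:C + b%:C + 2 * s%:C.
    rewrite -rmorphM -expr2 t2 (_ : 1 + 2 * s = a + b + s + s); last lra.
    by rewrite !rmorphD /=; ring.
  have TV : (t^-1)%:C = (t%:C)^-1 by rewrite fmorphV.
  apply: funext => x; apply: funext => x'; rewrite /opmul sum_qubit TV.
  have fin (p1 p2 p3 p4 w : C) : p1 * p2 + p3 * p4 = w * (t%:C * t%:C) ->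
      (t%:C)^-1 * p1 * ((t%:C)^-1 * p2) + (t%:C)^-1 * p3 * ((t%:C)^-1 * p4) = w.
    move=> E; transitivity ((p1 * p2 + p3 * p4) / (t%:C * t%:C)).
      by field.
    by rewrite E mulfK // mulf_neq0.
  apply: fin; rewrite T2.
  by case/orP: (qubitX x) => /eqP ->; case/orP: (qubitX x') => /eqP ->;
    rewrite !eqxx ?[x1 == x0]eq_sym ?(negPf x01) ?ra ?rb ?rz -/z;
    rewrite ?(mul0r, mul1r, addr0); ring: S2.
case: cid => B [/= Bpsd BB].
have [BJ [p p0 Bp] [r r0 Br] Bdet] := psd_qubit_det Bpsd.
move: Bdet; rewrite Bp Br /=; set w := B x0 x1 in BJ *; move=> Bdet.
have E0 : a = p ^+ 2 + sqn w.
  apply: (@complexI R); rewrite -ra -BB /opmul sum_qubit Bp BJ -/w mulJc.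
  by rewrite -rmorphM -rmorphD -expr2.
have E1 : b = sqn w + r ^+ 2.
  apply: (@complexI R); rewrite -rb -BB /opmul sum_qubit Br BJ -/w mulrC mulJc.
  by rewrite -rmorphM -rmorphD -expr2.
have Ez : sqn z = sqn w * (p + r) ^+ 2.
  rewrite /z -BB /opmul sum_qubit Bp Br -/w mulrC -mulrDr -rmorphD sqnM.
  by rewrite sqnC.
have sE : s = p * r - sqn w.
  apply/eqP; rewrite -(@eqrXn2 _ 2) //; last by rewrite subr_ge0.
  by rewrite s2 E0 E1 Ez; apply/eqP; ring.
rewrite /optr sum_qubit Bp Br -rmorphD -rmorphXn; congr (_ %:C).
rewrite (_ : 1 + 2 * s = a + b + 2 * s); last by rewrite ab1.
by rewrite E0 E1 sE; ring.
Qed.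

Lemma negpure_qubit (Y : finType) (f : X * Y -> C) : normalized f ->
  negpure f = Num.sqrt (2 * nsq (minors f)).
Proof. by move=> f1; rewrite /negpure trsqrt_qubit //= addrAC subrr add0r. Qed.

End Qubit.

Section Assistance.
Local Open Scope complex_scope.
Variables (R : realType) (X : finType) (x0 x1 : X).
Local Notation C := R[i].
Hypothesis x01 : x0 != x1.
Hypothesis qubitX : forall x, (x == x0) || (x == x1).

Local Notation minors := (minors x0 x1).

(** Polarization of the minors: symmetrized in [u] and [v], with the minors as its quadratic
    form. *)
Definition minor_kernel (Y : finType) (p : Y * Y) (u v : X * Y) : C :=
  2^-1 * ((u == (x0, p.1))%:R * (v == (x1, p.2))%:R
          - (u == (x1, p.1))%:R * (v == (x0, p.2))%:R
          + (v == (x0, p.1))%:R * (u == (x1, p.2))%:R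
          - (v == (x1, p.1))%:R * (u == (x0, p.2))%:R).

Lemma minor_kernelC (Y : finType) (p : Y * Y) u v :
  minor_kernel p u v = minor_kernel p v u.
Proof. by rewrite /minor_kernel; ring. Qed.

Lemma bform_minor_kernel (Y : finType) (f g : X * Y -> C) (p : Y * Y) :
  bform (@minor_kernel Y) f g p =
  2^-1 * (f (x0, p.1) * g (x1, p.2) - f (x1, p.1) * g (x0, p.2)
          + g (x0, p.1) * f (x1, p.2) - g (x1, p.1) * f (x0, p.2)).
Proof.
have delta (a b : X * Y) :
    f a * g b = \sum_u \sum_v (u == a)%:R * (v == b)%:R * f u * g v.
  rewrite (bigD1 a) //= (bigD1 b) //= !eqxx !mul1r.
  rewrite [X in _ + X + _]big1 ?addr0; last first.
    by move=> v /negPf ->; rewrite mulr0 !mul0r.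
  rewrite [X in _ + X]big1 ?addr0 // => u /negPf ->.
  by rewrite big1 // => v _; rewrite !mul0r.
rewrite [g (x0, p.1) * _]mulrC [g (x1, p.1) * _]mulrC !delta.
rewrite -sumrB -big_split -sumrB /= mulr_sumr; apply: eq_bigr => u _.
rewrite -sumrB -big_split -sumrB /= mulr_sumr; apply: eq_bigr => v _.
by rewrite /minor_kernel; ring.
Qed.

Lemma bform_minor_diag (Y : finType) (f : X * Y -> C) :
  bform (@minor_kernel Y) f f =1 minors f.
Proof.
move=> p; rewrite bform_minor_kernel /minors.
by field.
Qed.

Lemma nsqZ (P : finType) (a : C) (f : P -> C) :
  nsq (fun p => a * f p) = sqn a * nsq f.
Proof. by rewrite /nsq mulr_sumr; apply: eq_bigr => p _; rewrite sqnM. Qed.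

Lemma nsq_minorsZ (Y : finType) (a : R) (f : X * Y -> C) :
  nsq (minors (fun u => a%:C * f u)) = (a ^+ 2) ^+ 2 * nsq (minors f).
Proof.
rewrite -[RHS]/(_ * _) -(sqnC (a ^+ 2)) -nsqZ; apply: eq_bigr => p _.
by congr sqn; rewrite /minors expr2 rmorphM /=; ring.
Qed.

Lemma normalizedE (T : finType) (f : T -> C) : normalized f <-> nsq f = 1.
Proof.
have E : \sum_t f t * (f t)^*%R = (nsq f)%:C.
  by rewrite rmorph_sum /=; apply: eq_bigr => t _; rewrite -mulJc.
rewrite /normalized E; split=> [|->//] h.
by apply: (@complexI R).
Qed.

Lemma negpure_ge0 (Y : finType) (f : X * Y -> C) : normalized f -> 0 <= negpure f.
Proof. by move=> f1; rewrite (negpure_qubit x01) // sqrtr_ge0. Qed.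

(** The squared negativity is 4 det rho_X, at most (tr rho_X)^2 = 1. This makes the supremum in
    [negassist] one of a bounded set. *)
Lemma negpure_le1 (Y : finType) (f : X * Y -> C) : normalized f -> negpure f <= 1.
Proof.
move=> f1; rewrite (negpure_qubit x01) // -[leRHS]sqrtr1 ler_sqrt ?ler01 //.
have := nsq_minors x0 x1 f; rewrite !redX_diag (redX_herm f x0 x1) mulJc.
rewrite -rmorphM -rmorphB -(rmorph_nat (real_complex R)) -rmorphM => /complexI ->.
set a := nsq _; set b := nsq _.
have ab : a + b = 1.
  move/normalizedE: f1 => <-; rewrite /nsq.
  rewrite -(sum_qubit x01 qubitX (fun x => \sum_y sqn (f (x, y)))).
  by rewrite pair_bigA; apply: eq_bigr => -[x y].
have := sqn_ge0 (redX f x0 x1).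
have : 0 <= (a - b) ^+ 2 by apply: sqr_ge0.
have -> : (a - b) ^+ 2 = (a + b) ^+ 2 - 4 * (a * b) by ring.
rewrite ab expr1n.
lra.
Qed.

Lemma ens_value_bounds (Y : finType) (rho : op R (X * Y)%type) v :
  ens_value rho v -> 0 <= v <= 1.
Proof.
case=> m [p [phi [p0 p1 n1 _ ->]]]; rewrite sumr_ge0 /=; last first.
  by move=> i _; rewrite mulr_ge0 // negpure_ge0.
rewrite -p1; apply: ler_sum => i _.
by rewrite -[leRHS]mulr1 ler_wpM2l // negpure_le1.
Qed.

Lemma ens_value_le_negassist (Y : finType) (rho : op R (X * Y)%type) v :
  ens_value rho v -> v <= negassist rho.
Proof.
move=> hv; apply: ub_le_sup => //; exists 1 => w /= hw.
by case/andP: (ens_value_bounds hw).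
Qed.

Lemma negassist_ge0 (Y : finType) (rho : op R (X * Y)%type) : 0 <= negassist rho.
Proof.
have [[v hv]|none] := pselect (exists v, ens_value rho v).
  by apply: le_trans (ens_value_le_negassist hv); case/andP: (ens_value_bounds hv).
(* The supremum of the empty set is 0 by convention. *)
rewrite /negassist (_ : [set v | ens_value rho v]%classic = set0) ?sup0 //.
by rewrite -subset0 => v hv; apply: none; exists v.
Qed.

Lemma trace_gram (V J : finType) (psi : J -> V -> C) :
  \sum_u gram psi u u = (\sum_j nsq (psi j))%:C.
Proof.
rewrite /gram exchange_big rmorph_sum /=; apply: eq_bigr => j _.
by rewrite rmorph_sum /=; apply: eq_bigr => u _; rewrite -mulJc.
Qed.

(** Squared norms serve as weights. Since minors are quadratic, each summand is the weight times the
    negativity of the normalized vector. *)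
Lemma negassist_ge (Y J : finType) (chi : J -> X * Y -> C)
    (rho : op R (X * Y)%type) :
  (forall u w, rho u w = gram chi u w) -> \sum_j nsq (chi j) = 1 ->
  \sum_j Num.sqrt (2 * nsq (minors (chi j))) <= negassist rho.
Proof.
move=> rhoE tr1; pose p j := nsq (chi j).
have p0 j : 0 <= p j by apply: nsq_ge0.
have nz j : p j != 0 -> exists2 phi : X * Y -> C, normalized phi &
    forall u, chi j u = (Num.sqrt (p j))%:C * phi u.
  move=> pj; exists (fun u => ((Num.sqrt (p j))^-1)%:C * chi j u).
    by apply/normalizedE; rewrite nsqZ sqnC exprVn sqr_sqrtr // mulVf.
  move=> u; rewrite mulrA -rmorphM divff ?rmorph1 ?mul1r //.
  by rewrite sqrtr_eq0 -ltNge lt_neqAle eq_sym pj p0.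
have [j0 pj0] : exists j, p j != 0.
  apply: contrapT => /forallNP all0; move: tr1; rewrite big1 => [|j _].
    by move/eqP; rewrite eq_sym oner_eq0.
  by have /negP/negPn/eqP := all0 j.
(* Zero vectors have weight zero and borrow the normalized vector of the member [j0]. *)
have /choice[phi phiP] : forall j, exists f : X * Y -> C, normalized f /\
    forall u, chi j u = (Num.sqrt (p j))%:C * f u.
  move=> j.
  have [pj|/nz[f f1 fE]] := eqVneq (p j) 0; last by exists f.
  have [f f1 _] := nz _ pj0; exists f; split=> // u.
  rewrite pj sqrtr0 mul0r.
  have : sqn (chi j u) <= 0.
    by rewrite -pj /p /nsq (bigD1 u) //= lerDl sumr_ge0 // => *; apply: sqn_ge0.
  case: (chi j u) => a b; rewrite /sqn /=.
  have := sqr_ge0 a; have := sqr_ge0 b => b0 a0 ab.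
  have /eqP : a ^+ 2 = 0 by lra.
  have /eqP : b ^+ 2 = 0 by lra.
  by rewrite !sqrf_eq0 => /eqP -> /eqP ->.
have valE j : Num.sqrt (2 * nsq (minors (chi j))) = p j * negpure (phi j).
  have [f1 fE] := phiP j; rewrite (negpure_qubit x01) //.
  rewrite (funext fE) nsq_minorsZ sqr_sqrtr // mulrCA sqrtrM ?sqr_ge0 //.
  by rewrite sqrtr_sqr ger0_norm.
under eq_bigr => j _ do rewrite valE.
have toI (W : zmodType) (F : J -> W) :
    \sum_(i < #|J|) F (enum_val i) = \sum_j F j.
  by rewrite -(big_enum_val F); apply: eq_bigl.
apply: ens_value_le_negassist.
exists #|J|, (fun i => p (enum_val i)), (fun i => phi (enum_val i)); split.
- by move=> i.
- by rewrite toI.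
- by move=> i; case: (phiP (enum_val i)).
- move=> u w; rewrite rhoE (toI _ (fun j => (p j)%:C * phi j u * (phi j w)^*%R)).
  apply: eq_bigr => j _; have [_ fE] := phiP j.
  have : conjc (Num.sqrt (p j))%:C = (Num.sqrt (p j))%:C := conjc_real _.
  have : (p j)%:C = (Num.sqrt (p j))%:C * (Num.sqrt (p j))%:C.
    by rewrite -rmorphM -expr2 sqr_sqrtr.
  rewrite !fE; move: ((Num.sqrt (p j))%:C) => r -> rJ.
  by rewrite rmorphM /= rJ; ring.
- by rewrite (toI _ (fun j => p j * negpure (phi j))).
Qed.

End Assistance.

(** * Polygamy of assistance when the second system splits *)

Section Polygamy.
Local Open Scope complex_scope.
Variables (R : realType) (X : finType) (x0 x1 : X).
Local Notation C := R[i].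
Hypothesis x01 : x0 != x1.
Hypothesis qubitX : forall x, (x == x0) || (x == x1).

Local Notation minors := (minors x0 x1).
Local Notation mker := (@minor_kernel R X x0 x1 _).

Definition slices (Y B D : finType) (j : B -> D -> Y) (f : X * Y -> C) (d : D)
  (u : X * B) : C := f (u.1, j u.2 d).

(** Bijectivity of [j] as a map from pairs to [Y], stated as the reindexing of sums in which it is
    used. *)
Definition sum_decomposed (Y B D : finType) (j : B -> D -> Y) : Prop :=
  forall (W : zmodType) (F : Y -> W), \sum_y F y = \sum_b \sum_d F (j b d).

Lemma nsq_slices (Y B D : finType) (j : B -> D -> Y) (f : X * Y -> C) :
  sum_decomposed j -> \sum_d nsq (slices j f d) = nsq f.
Proof.
move=> jP; rewrite exchange_big /=.
transitivity (\sum_x \sum_y sqn (f (x, y))); last first.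
  by rewrite pair_bigA; apply: eq_bigr => -[x y].
transitivity (\sum_x \sum_b \sum_d sqn (f (x, j b d))).
  by rewrite [RHS]pair_bigA; apply: eq_bigr => -[x b].
by apply: eq_bigr => x _; rewrite jP.
Qed.

(* Each member of the ensemble is a purification of its part on X B; the purifying
   system D supplies the ensembles among which diagsum_approx chooses. *)
Lemma negassist_ge_frob (Y B D : finType) (j : B -> D -> Y) (m : nat)
    (p : 'I_m -> R) (phi : 'I_m -> X * Y -> C) (rhoB : op R (X * B)%type) (eps : R) :
  sum_decomposed j -> (forall i, 0 <= p i) -> \sum_i p i = 1 ->
  (forall i, normalized (phi i)) ->
  (forall u w, rhoB u w = \sum_i (p i)%:C * gram (slices j (phi i)) u w) ->
  0 < eps ->
  \sum_i p i * Num.sqrt (2 * frob mker (slices j (phi i))) - eps <= negassist rhoB.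
Proof.
move=> jP p0 p1 phi1 rhoE eps0.
pose c : R := Num.sqrt 2.
have c0 : 0 < c by rewrite sqrtr_gt0.
(* The loss [eps / c] per member is multiplied by c = sqrt 2 in the negativity, so the weighted
   average loses at most [eps]. *)
have /choice[psi psiP] : forall i, exists psi : D -> X * B -> C,
    (forall u w, gram psi u w = gram (slices j (phi i)) u w) /\
    Num.sqrt (frob mker (slices j (phi i))) - eps / c <= diagsum mker psi.
  move=> i; have [|psi G le] := @diagsum_approx R _ _ mker
    (@minor_kernelC R X x0 x1 B) D (slices j (phi i)) (eps / c).
  - by rewrite divr_gt0.
  - by exists psi.
pose chi (jd : 'I_m * D) u : C := (Num.sqrt (p jd.1))%:C * psi jd.1 jd.2 u.
have chiE u w : gram chi u w = \sum_i (p i)%:C * gram (psi i) u w.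
  rewrite /gram -(pair_bigA _ (fun i d => chi (i, d) u * conjc (chi (i, d) w))) /=.
  apply: eq_bigr => i _; rewrite mulr_sumr; apply: eq_bigr => d _; rewrite /chi /=.
  have : conjc (Num.sqrt (p i))%:C = (Num.sqrt (p i))%:C := conjc_real _.
  have : (p i)%:C = (Num.sqrt (p i))%:C * (Num.sqrt (p i))%:C.
    by rewrite -rmorphM -expr2 sqr_sqrtr.
  move: ((Num.sqrt (p i))%:C) => r -> rJ.
  by rewrite rmorphM /= rJ; ring.
have G u w : rhoB u w = gram chi u w.
  by rewrite rhoE chiE; apply: eq_bigr => i _; rewrite (psiP i).1.
have tr1 : \sum_jd nsq (chi jd) = 1.
  apply: (@complexI R); rewrite -trace_gram.
  under eq_bigr => u _ do rewrite -G rhoE.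
  rewrite exchange_big /= -p1 rmorph_sum /=; apply: eq_bigr => i _.
  rewrite -mulr_sumr trace_gram nsq_slices //.
  by have /normalizedE -> := phi1 i; rewrite mulr1.
apply: le_trans (negassist_ge x01 qubitX G tr1).
rewrite -(pair_bigA _ (fun i d => Num.sqrt (2 * nsq (minors (chi (i, d)))))) /=.
have -> : \sum_i p i * Num.sqrt (2 * frob mker (slices j (phi i))) - eps =
    \sum_i p i * (c * (Num.sqrt (frob mker (slices j (phi i))) - eps / c)).
  have epsE : \sum_i p i * eps = eps by rewrite -mulr_suml p1 mul1r.
  rewrite -[X in _ - X = _]epsE -sumrB; apply: eq_bigr => i _.
  rewrite -mulrBr; congr (_ * _); rewrite sqrtrM ?ler0n // -/c mulrBr.
  by rewrite mulrCA divff ?mulr1 // gt_eqF.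
apply: ler_sum => i _.
have -> : \sum_d Num.sqrt (2 * nsq (minors (chi (i, d)))) =
    p i * (c * diagsum mker (psi i)).
  rewrite /diagsum !mulr_sumr; apply: eq_bigr => d _.
  rewrite nsq_minorsZ sqr_sqrtr // mulrCA sqrtrM ?sqr_ge0 // sqrtr_sqr ger0_norm //.
  congr (_ * _); rewrite sqrtrM ?ler0n // /norm2; congr (_ * Num.sqrt _).
  by apply: eq_bigr => q _; rewrite bform_minor_diag.
by apply: ler_wpM2l => //; apply: ler_wpM2l; [exact: ltW | case: (psiP i)].
Qed.

(* Antisymmetry of the minors under exchanging the two columns turns the part
   symmetric in D into the part antisymmetric in B and vice versa. *)
Lemma nsq_minors_split (Y B D : finType) (j : B -> D -> Y) (f : X * Y -> C) :
  sum_decomposed j ->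
  nsq (minors f) = frob mker (slices j f) + frob mker (slices (fun d b => j b d) f).
Proof.
move=> jP.
pose M b d b' d' := minors f (j b d, j b' d').
have -> : nsq (minors f) = \sum_b \sum_b' \sum_d \sum_d' sqn (M b d b' d').
  rewrite /nsq -(pair_bigA _ (fun y y' => sqn (minors f (y, y')))) /= jP /=.
  apply: eq_bigr => b _.
  under eq_bigr => d _ do rewrite jP.
  by rewrite exchange_big.
have -> : frob mker (slices j f) =
    \sum_b \sum_b' \sum_d \sum_d' sqn (2^-1 * (M b d b' d' + M b d' b' d)).
  rewrite pair_bigA /= [RHS]exchange_big /=; apply: eq_bigr => d _.
  rewrite [RHS]exchange_big /=; apply: eq_bigr => d' _.
  apply: eq_bigr => -[b b'] _; rewrite bform_minor_kernel /M /minors /slices /=.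
  by congr sqn; ring.
have -> : frob mker (slices (fun d b => j b d) f) =
    \sum_b \sum_b' \sum_d \sum_d' sqn (2^-1 * (M b d b' d' - M b d' b' d)).
  apply: eq_bigr => b _; apply: eq_bigr => b' _.
  rewrite [RHS]pair_bigA /=; apply: eq_bigr => -[d d'] _.
  rewrite bform_minor_kernel /M /minors /slices /=.
  by congr sqn; ring.
(* Parallelogram law; exchanging [d] and [d'] afterwards identifies the two halves. *)
have pl (z w : C) : sqn (2^-1 * (z + w)) + sqn (2^-1 * (z - w)) =
    2^-1 * sqn z + 2^-1 * sqn w.
  have half : (2^-1 : C) = (2^-1 : R)%:C by rewrite fmorphV rmorph_nat.
  rewrite !sqnM half sqnC; case: z w => [a b] [a' b']; rewrite /sqn /=.
  by field.
rewrite -big_split /=; apply: eq_bigr => b _.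
rewrite -big_split /=; apply: eq_bigr => b' _.
rewrite -big_split /=.
under [RHS]eq_bigr => d _ do (rewrite -big_split /=;
  under eq_bigr => d' _ do rewrite pl; rewrite big_split /=).
rewrite big_split /= [X in _ = _ + X]exchange_big /= -big_split /=.
apply: eq_bigr => d _; rewrite -big_split /=; apply: eq_bigr => d' _.
by field.
Qed.

Lemma sqrtrD_le (x y : R) : 0 <= x -> 0 <= y ->
  Num.sqrt (x + y) <= Num.sqrt x + Num.sqrt y.
Proof.
move=> xp yp; rewrite -(@ler_pXn2r _ 2) ?nnegrE ?addr_ge0 ?sqrtr_ge0 //.
by rewrite sqrrD !sqr_sqrtr ?addr_ge0 // addrAC lerDl mulrn_wge0 // mulr_ge0.
Qed.

(** For each ensemble member sqrt(2 F_B + 2 F_D) <= sqrt(2 F_B) + sqrt(2 F_D), and each of the two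
    resulting averages is at most the corresponding assistance plus e / 2. *)
Lemma negassist_polygamy (Y B D : finType) (j : B -> D -> Y)
    (rho : op R (X * Y)%type) (rhoB : op R (X * B)%type) (rhoD : op R (X * D)%type) :
  sum_decomposed j ->
  (forall u w, rhoB u w = \sum_d rho (u.1, j u.2 d) (w.1, j w.2 d)) ->
  (forall u w, rhoD u w = \sum_b rho (u.1, j b u.2) (w.1, j b w.2)) ->
  negassist rho <= negassist rhoB + negassist rhoD.
Proof.
move=> jP rhoBE rhoDE.
have jP' : sum_decomposed (fun d b => j b d).
  by move=> W F; rewrite jP exchange_big.
have [[v0 hv0]|none] := pselect (exists v, ens_value rho v); last first.
  rewrite {1}/negassist (_ : [set v | ens_value rho v]%classic = set0) ?sup0.
    by rewrite addr_ge0 // (negassist_ge0 x01).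
  by rewrite -subset0 => v hv; apply: none; exists v.
apply: ge_sup; first by exists v0.
move=> v [m [p [phi [p0 p1 phi1 rhoE ->]]]].
apply/ler_addgt0Pr => e e0.
have e20 : 0 < e / 2 by rewrite divr_gt0.
have redE (B' D' : finType) (j' : B' -> D' -> Y) u w :
    \sum_d rho (u.1, j' u.2 d) (w.1, j' w.2 d) =
    \sum_i (p i)%:C * gram (slices j' (phi i)) u w.
  under eq_bigr => d _ do rewrite rhoE.
  rewrite exchange_big /=; apply: eq_bigr => i _.
  by rewrite mulr_sumr; apply: eq_bigr => d _; rewrite mulrA.
have hB : forall u w, rhoB u w = \sum_i (p i)%:C * gram (slices j (phi i)) u w.
  by move=> u w; rewrite rhoBE redE.
have hD : forall u w, rhoD u w =
    \sum_i (p i)%:C * gram (slices (fun d b => j b d) (phi i)) u w.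
  by move=> u w; rewrite rhoDE (redE _ _ (fun d b => j b d)).
have := negassist_ge_frob jP p0 p1 phi1 hB e20.
have := negassist_ge_frob jP' p0 p1 phi1 hD e20.
suff : \sum_i p i * negpure (phi i) <=
    \sum_i p i * Num.sqrt (2 * frob mker (slices j (phi i))) +
    \sum_i p i * Num.sqrt (2 * frob mker (slices (fun d b => j b d) (phi i))).
  lra.
rewrite -big_split; apply: ler_sum => i _ /=; rewrite -mulrDr ler_wpM2l //.
rewrite (negpure_qubit x01) // (nsq_minors_split _ jP) mulrDr.
by apply: sqrtrD_le; rewrite mulr_ge0 // /frob;
  do 2 apply: sumr_ge0 => ? _; apply: nsq_ge0.
Qed.

End Polygamy.

(** * Multi-qubit configurations *)

Section Configurations.
Variable n : nat.
Implicit Types S : {set 'I_n}.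

Lemma getc_in S (x : qconf S) (i : {i : 'I_n | i \in S}) : getc x (val i) = x i.
Proof. by rewrite /getc valK. Qed.

Lemma getc_notin S (x : qconf S) i : i \notin S -> getc x i = false.
Proof. by move=> iS; rewrite /getc insubN. Qed.

Lemma getc_inj S (x y : qconf S) : getc x =1 getc y -> x = y.
Proof. by move=> h; apply/ffunP => i; rewrite -!getc_in h. Qed.

Definition mkconf S (f : 'I_n -> bool) : qconf S := [ffun i => f (val i)].

Lemma getc_mkconf S f i : getc (mkconf S f) i = (i \in S) && f i.
Proof.
have [iS|iS] := boolP (i \in S); last exact: getc_notin.
by have /= -> := getc_in (mkconf S f) (exist _ i iS); rewrite ffunE.
Qed.

Definition joinc (S S1 S2 : {set 'I_n}) (x : qconf S1) (y : qconf S2) : qconf S :=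
  mkconf S (fun i => if i \in S1 then getc x i else getc y i).

Lemma getc_joinc S1 S2 S (x : qconf S1) (y : qconf S2) i :
  S = S1 :|: S2 -> getc (joinc S x y) i = if i \in S1 then getc x i else getc y i.
Proof.
move=> ->; rewrite getc_mkconf inE; have [iS1|iS1] //= := boolP (i \in S1).
by have [iS2|iS2] := boolP (i \in S2); rewrite //= getc_notin.
Qed.

Lemma sum_joinc S1 S2 S (W : zmodType) (F : qconf S -> W) :
  S = S1 :|: S2 -> [disjoint S1 & S2] ->
  (\sum_z F z = \sum_(x : qconf S1) \sum_(y : qconf S2) F (joinc S x y))%R.
Proof.
move=> SE dis; rewrite pair_bigA /=.
rewrite (reindex (fun p : qconf S1 * qconf S2 => joinc S p.1 p.2)) //.
exists (fun z => (mkconf S1 (getc z), mkconf S2 (getc z))) => [[x y] _|z _].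
  congr pair; apply: getc_inj => i; rewrite getc_mkconf getc_joinc //=.
    by have [//|iS1] /= := boolP (i \in S1); rewrite getc_notin.
  have [iS2|iS2] /= := boolP (i \in S2); last by rewrite getc_notin.
  by rewrite (disjointFl dis iS2).
apply: getc_inj => i; rewrite getc_joinc // !getc_mkconf.
have [iS1|iS1] //= := boolP (i \in S1).
have [iS2|iS2] //= := boolP (i \in S2).
by rewrite getc_notin // SE inE negb_or iS1.
Qed.

End Configurations.

(** The complement of [SX] and [SB] is the disjoint union of [SD] and the complement of [SX] and
    [S], so the partial trace can be taken in two stages. *)
Lemma redbip_joinc (R : realType) n (rho : op R {ffun 'I_n -> bool})
    (SX S SB SD : {set 'I_n}) u w :
  S = SB :|: SD -> [disjoint SX & S] -> [disjoint SB & SD] ->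
  redbip rho (SX := SX) (SY := SB) u w =
  \sum_(d : qconf SD) redbip rho (SX := SX) (SY := S)
    (u.1, joinc S u.2 d) (w.1, joinc S w.2 d).
Proof.
move=> SE disX dis.
have rest : ~: (SX :|: SB) = SD :|: ~: (SX :|: S).
  apply/setP => i; rewrite SE !inE.
  have [iX|iX] /= := boolP (i \in SX).
    by have := disjointFr disX iX; rewrite SE inE => /norP[_ /negPf ->].
  have [iB|iB] /= := boolP (i \in SB); first by rewrite (disjointFr dis iB).
  by case: (i \in SD).
have disD : [disjoint SD & ~: (SX :|: S)].
  rewrite finset.disjoints_subset finset.setCK SE.
  by apply/fintype.subsetP => i iD; rewrite !inE iD !orbT.
rewrite /redbip (sum_joinc _ rest disD); apply: eq_bigr => d _.
have glueE (v : qconf SX * qconf SB) z : glue v.1 v.2 (joinc (~: (SX :|: SB)) d z) =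
    glue v.1 (joinc S v.2 d) z.
  apply/ffunP => i; rewrite !ffunE !getc_joinc //.
  have -> : (i \in S) = (i \in SB) || (i \in SD) by rewrite SE inE.
  have [//|iX] := boolP (i \in SX).
  by have [iB|iB] /= := boolP (i \in SB).
by apply: eq_bigr => z _; rewrite !glueE.
Qed.

Lemma joincC n (S S1 S2 : {set 'I_n}) (x : qconf S1) (y : qconf S2) :
  S = S1 :|: S2 -> [disjoint S1 & S2] -> joinc S x y = joinc S y x.
Proof.
move=> SE dis; have SE' : S = S2 :|: S1 by rewrite SE finset.setUC.
apply: getc_inj => i; rewrite !getc_joinc //.
have [iS1|iS1] := boolP (i \in S1); first by rewrite (disjointFr dis iS1).
by have [//|iS2] := boolP (i \in S2); rewrite !getc_notin.
Qed.

(** * Polygamy for the first qubit against successive tails *)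

Section QubitStates.
Variables (R : realType) (n : nat) (rho : op R {ffun 'I_n -> bool}).

Let off : qconf (qA1 n) := mkconf (qA1 n) (fun=> false).
Let on : qconf (qA1 n) := mkconf (qA1 n) (fun=> true).

Lemma off_neq_on : (0 < n)%N -> off != on.
Proof.
move=> n0; apply/eqP => /(congr1 (fun x => getc x (Ordinal n0))).
by rewrite !getc_mkconf !inE.
Qed.

Lemma qA1_qubit (x : qconf (qA1 n)) : (x == off) || (x == on).
Proof.
have getcE (y : qconf (qA1 n)) (i i' : 'I_n) :
    i \in qA1 n -> i' \in qA1 n -> getc y i = getc y i'.
  by rewrite !inE => /eqP i0 /eqP i'0; congr getc; apply: val_inj; rewrite i0.
have [/existsP[i /andP[i0 xi]]|/existsPn none] :=
    boolP [exists i, (i \in qA1 n) && getc x i]; apply/orP; [right | left];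
  apply/eqP/getc_inj => i'; rewrite getc_mkconf;
  have [i'0|i'0] /= := boolP (i' \in qA1 n); rewrite ?(getc_notin _ i'0) //.
- by rewrite (getcE _ _ _ i'0 i0).
- by have := none i'; rewrite i'0 /= => /negPf.
Qed.

Lemma NaPair_ge0 i : (0 < n)%N -> 0 <= NaPair rho i.
Proof. by move=> n0; apply: (negassist_ge0 (off_neq_on n0) qA1_qubit). Qed.

Lemma NaTail_ge0 i : (0 < n)%N -> 0 <= NaTail rho i.
Proof. by move=> n0; apply: (negassist_ge0 (off_neq_on n0) qA1_qubit). Qed.

Lemma NaTail_last : (0 < n)%N -> NaTail rho (n - 1) = NaPair rho n.
Proof.
move=> n0; rewrite /NaTail /NaPair; have -> // :
  qset n (fun k => n - 1 <= k)%N = qset n (fun k => k == n.-1).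
by apply/setP => -[i hi]; rewrite !inE /=; apply/idP/eqP; lia.
Qed.

(** Qubit indices start at 0, so [NaTail rho i.-1] is the cut A_1 against A_i ... A_n; its second
    side splits into A_i and the later qubits, of which there are none for i = n. *)
Lemma NaTail_polygamy i : (2 <= i <= n)%N ->
  NaTail rho i.-1 <= NaPair rho i + NaTail rho i.
Proof.
move=> /andP[i2 i_n]; have n0 : (0 < n)%N by lia.
set SB := qset n (fun k => k == i.-1); set SD := qset n (fun k => i <= k)%N.
set S := qset n (fun k => i.-1 <= k)%N.
have SE : S = SB :|: SD by apply/setP => k; rewrite !inE; lia.
have SE' : S = SD :|: SB by rewrite SE finset.setUC.
have disX : [disjoint qA1 n & S].
  by rewrite disjoint_subset; apply/fintype.subsetP => k; rewrite !inE; lia.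
have dis : [disjoint SB & SD].
  by rewrite disjoint_subset; apply/fintype.subsetP => k; rewrite !inE; lia.
have dis' : [disjoint SD & SB] by rewrite disjoint_sym.
apply: (negassist_polygamy (off_neq_on n0) qA1_qubit
  (j := fun (b : qconf SB) (d : qconf SD) => joinc S b d)).
- by move=> W F; apply: sum_joinc.
- by move=> u w; apply: redbip_joinc.
- move=> u w; rewrite (redbip_joinc rho u w SE' disX dis').
  by apply: eq_bigr => b _; rewrite !(joincC b _ SE dis).
Qed.

End QubitStates.

(** * Iteration of the one-step inequalities *)

Lemma chain_le_low (R : realType) (T P : nat -> R) (A l : R) (m : nat) :
  0 <= l -> (1 <= m)%N ->
  (forall i, (2 <= i <= m)%N -> T i.-1 <= A * P i + l * T i) ->
  T 1%N <= A * (\sum_(2 <= i < m.+1) l ^+ (i - 2) * P i) + l ^+ (m - 1) * T m.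
Proof.
move=> l0; case: m => // m _; elim: m => [|m IH] step.
  by rewrite big_geq // mulr0 add0r expr0 mul1r.
apply: le_trans (IH _) _; first by move=> i hi; apply: step; lia.
rewrite [in leRHS]big_nat_recr //= mulrDr -addrA lerD2l !subSS !subn0.
have stepm : T m.+1 <= A * P m.+2 + l * T m.+2 by apply: (step m.+2); lia.
apply: le_trans (ler_wpM2l (exprn_ge0 m l0) stepm) _.
by rewrite exprSr le_eqVlt; apply/orP; left; apply/eqP; ring.
Qed.

Lemma chain_le_high (R : realType) (T P : nat -> R) (l Q : R) (m r : nat) :
  0 <= Q -> (m <= r)%N ->
  (forall j, (m < j <= r)%N -> T j.-1 <= l * P j + Q * T j) ->
  T m <= l * (\sum_(m.+1 <= j < r.+1) Q ^+ (j - m - 1) * P j) + Q ^+ (r - m) * T r.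
Proof.
move=> Q0 /subnKC <-; move: (r - m)%N => {}r; elim: r => [|r IH] step.
  by rewrite addn0 big_geq // subnn mulr0 add0r expr0 mul1r.
apply: le_trans (IH _) _; first by move=> i hi; apply: step; lia.
rewrite addnS [in leRHS]big_nat_recr /= ?ltnS ?leq_addr // mulrDr -addrA lerD2l.
have -> : ((m + r).+1 - m - 1 = r)%N by lia.
have -> : ((m + r).+1 - m = r.+1)%N by lia.
have -> : (m + r - m = r)%N by lia.
have stepr : T (m + r)%N <= l * P (m + r).+1 + Q * T (m + r).+1.
  by apply: (step (m + r).+1); lia.
apply: le_trans (ler_wpM2l (exprn_ge0 r Q0) stepr) _.
by rewrite exprSr le_eqVlt; apply/orP; left; apply/eqP; ring.
Qed.

Unset Implicit Arguments.

Theorem theorem5 (R : realType) (n : nat) (rho : op R {ffun 'I_n -> bool})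
    (k q s beta : R) :
  density rho -> 1 <= k -> 0 < q <= 1 -> 0 < s <= 1 -> s <= beta ->
  let l := ((1 + k) `^ (beta / s) - q `^ (beta / s)) / k `^ (beta / s) in
  let NP i := NaPair rho i in
  let NT j := NaTail rho j in
  (* (1) *)
  (forall m : nat, (4 <= n)%N -> (2 <= m <= n - 2)%N ->
     (forall i : nat, (2 <= i <= m)%N -> k * NP i `^ s <= NT i `^ s) ->
     (forall j : nat, (m + 1 <= j <= n - 1)%N -> NP j `^ s >= k * NT j `^ s) ->
     NT 1%N `^ beta <=
       q `^ (beta / s) * (\sum_(2 <= i < m.+1) l ^+ (i - 2) * NP i `^ beta)
       + l ^+ m * (\sum_(m.+1 <= j < n) q `^ ((j - m - 1)%:R * (beta / s)) * NP j `^ beta)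
       + l ^+ (m - 1) * q `^ ((n - m - 1)%:R * (beta / s)) * NP n `^ beta) /\
  (* (2) *)
  ((3 <= n)%N ->
     (forall i : nat, (2 <= i <= n - 1)%N -> k * NP i `^ s <= NT i `^ s) ->
     NT 1%N `^ beta <=
       q `^ (beta / s) * (\sum_(2 <= i < n) l ^+ (i - 2) * NP i `^ beta)
       + l ^+ (n - 2) * NP n `^ beta) /\
  (* (3) *)
  ((3 <= n)%N ->
     (forall j : nat, (2 <= j <= n - 1)%N -> NP j `^ s >= k * NT j `^ s) ->
     NT 1%N `^ beta <=
       l * (\sum_(2 <= j < n) q `^ ((j - 2)%:R * (beta / s)) * NP j `^ beta)
       + q `^ ((n - 2)%:R * (beta / s)) * NP n `^ beta).
Proof.
move=> _ k1 q01 /[dup] s01 /andP[s0 s1] sb l NP NT.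
have k0 : 0 < k by apply: lt_le_trans k1.
have [q0 q1] := andP q01.
set t := beta / s in l *; pose Q := q `^ t.
have t1 : 1 <= t by rewrite ler_pdivlMr // mul1r.
have t0 : 0 <= t by apply: le_trans t1.
have l0 : 0 <= l.
  apply: divr_ge0 (powR_ge0 _ _); rewrite subr_ge0.
  by apply: ge0_ler_powR => //; rewrite ?nnegrE; lra.
have Q0 : 0 <= Q by apply: powR_ge0.
have QX j : q `^ (j%:R * t) = Q ^+ j.
  by rewrite mulrC powRrM powR_mulrn // powR_ge0.
have powst x : x `^ beta = (x `^ s) `^ t.
  by rewrite -powRrM mulrC divfK // gt_eqF.
(* Polygamy, then subadditivity of x^s, then the monotone power t = beta / s. *)
have add_pow i : (2 <= i <= n)%N -> NT i.-1 `^ beta <= (NP i `^ s + NT i `^ s) `^ t.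
  move=> hi; have n0 : (0 < n)%N by case/andP: hi => i2; apply: leq_trans; apply: ltnW.
  have NP0 := NaPair_ge0 rho i n0; have NT0 j := NaTail_ge0 rho j n0.
  rewrite powst; apply: ge0_ler_powR; rewrite ?nnegrE ?addr_ge0 ?powR_ge0 //.
  apply: le_trans (powR_subadditive s01 NP0 (NT0 i)).
  by apply: ge0_ler_powR; rewrite ?nnegrE ?addr_ge0 ?(ltW s0) // NaTail_polygamy.
have low i : (2 <= i <= n)%N -> k * NP i `^ s <= NT i `^ s ->
    NT i.-1 `^ beta <= Q * NP i `^ beta + l * NT i `^ beta.
  move=> hi le; apply: le_trans (add_pow i hi) _; rewrite addrC (powst (NP i)) (powst (NT i)).
  exact: powR_add_le_weighted (powR_ge0 _ _) le.
(* The pair now dominates the tail, so [l] and [Q] change places. *)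
have high i : (2 <= i <= n)%N -> k * NT i `^ s <= NP i `^ s ->
    NT i.-1 `^ beta <= l * NP i `^ beta + Q * NT i `^ beta.
  move=> hi le; apply: le_trans (add_pow i hi) _.
  rewrite [leRHS]addrC (powst (NP i)) (powst (NT i)).
  exact: powR_add_le_weighted (powR_ge0 _ _) le.
have last : (3 <= n)%N -> NT (n - 1)%N = NP n.
  by move=> n3; apply: NaTail_last; apply: leq_trans n3.
(* [low], [high] and [last] now carry everything about the state; the rest is iteration. *)
rewrite -/Q; clearbody NP NT Q l t; clear add_pow powst t1 t0.
split; [|split].
- move=> m n4 hm lo hi.
  have [m1 mn en1 enm em] : [/\ (1 <= m)%N, (m <= n - 1)%N, (n - 1).+1 = n,
    (n - 1 - m = n - m - 1)%N & m = (m - 1).+1] by clear - n4 hm; split; lia.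
  have A i : (2 <= i <= m)%N -> NT i.-1 `^ beta <= Q * NP i `^ beta + l * NT i `^ beta.
    by move=> im; apply: low (lo _ im); clear - im hm; lia.
  have B j : (m < j <= n - 1)%N ->
      NT j.-1 `^ beta <= l * NP j `^ beta + Q * NT j `^ beta.
    by move=> jm; apply: high (hi _ _); clear - jm hm; lia.
  (* [low] is iterated up to index [m], then [high] from [m] to n - 1, where the tail is the single
     qubit A_n; the bracket gets l^(m-1) l = l^m. *)
  apply: le_trans (chain_le_low (T := fun i => NT i `^ beta) l0 m1 A) _.
  rewrite -addrA lerD2l.
  apply: le_trans (ler_wpM2l (exprn_ge0 (m - 1) l0)
    (chain_le_high (T := fun i => NT i `^ beta) Q0 mn B)) _.
  rewrite last ?(ltnW n4) // en1 enm QX [in l ^+ m]em exprSr.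
  rewrite mulrDr !mulrA lerD2r ler_wpM2l ?mulr_ge0 ?exprn_ge0 //.
  by apply: ler_sum => j _; rewrite QX.
- move=> n3 lo.
  have [n1 en1 en2] : [/\ (1 <= n - 1)%N, (n - 1).+1 = n & (n - 1 - 1 = n - 2)%N].
    by clear - n3; split; lia.
  have A i : (2 <= i <= n - 1)%N ->
      NT i.-1 `^ beta <= Q * NP i `^ beta + l * NT i `^ beta.
    by move=> im; apply: low (lo _ im); clear - im; lia.
  apply: le_trans (chain_le_low (T := fun i => NT i `^ beta) l0 n1 A) _.
  by rewrite last // en1 en2.
- move=> n3 hi.
  have [n1 en1 en2] : [/\ (1 <= n - 1)%N, (n - 1).+1 = n & (n - 1 - 1 = n - 2)%N].
    by clear - n3; split; lia.
  have B j : (1 < j <= n - 1)%N ->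
      NT j.-1 `^ beta <= l * NP j `^ beta + Q * NT j `^ beta.
    by move=> jm; apply: high (hi _ jm); clear - jm; lia.
  (* The chain starts at index 1, whence the exponents j - 1 - 1. *)
  apply: le_trans (chain_le_high (T := fun i => NT i `^ beta) Q0 n1 B) _.
  rewrite last // en1 en2 QX lerD2r ler_wpM2l //; apply: ler_sum => j _.
  by rewrite QX -subnDA.
Qed.
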